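(* Let $o,p\ge1$ be integers, $I\ge 2$, $\mathcal I=\{1,\dots,I\}$, $N\ge 1$, let $a_k,\bar a_k,b_{ik},\bar b_{ik}\in\mathbb R$ and $q_{ik},q_{iN},r_{ik},\bar q_{ik},\bar q_{iN},\bar r_{ik}>0$ for $i\in\mathcal I$, $k\in\{0,\dots,N-1\}$. Let $\{\epsilon_k\}_k$ be a zero-mean real random process with $\epsilon_0=0$, let $x_0$ be a given real random variable independent of $\epsilon$, and put $m_{k+1,2o}=\mathbb E[\epsilon_{k+1}^{2o}]$. Consider the scalar system $$x_{k+1}=\left(\bar a_k\bar x_k+\sum_{i\in\mathcal I}\bar b_{ik}\bar u_{ik}\right)+\left(a_k(x_k-\bar x_k)+\sum_{i\in\mathcal I}b_{ik}(u_{ik}-\bar u_{ik})\right)\epsilon_{k+1},\qquad k\in\{0,\dots,N-1\},$$ where $\bar x_k=\mathbb E[x_k]$ and $\bar u_{ik}=\mathbb E[u_{ik}]$, in which each agent $i\in\mathcal I$ chooses $(u_{ik})_{k=0}^{N-1}$ in order to minimize the expected value of $$L_i(x_0,u)=q_{iN}\mathbb E[(x_N-\bar x_N)^{2o}]+\bar q_{iN}\bar x_N^{2p}+\sum_{k=0}^{N-1}\left(q_{ik}\mathbb E[(x_k-\bar x_k)^{2o}]+\bar q_{ik}\bar x_k^{2p}+r_{ik}\mathbb E[(u_{ik}-\bar u_{ik})^{2o}]+\bar r_{ik}\bar u_{ik}^{2p}\right).$$ Then the equilibrium strategy of the game is $$u_{ik}^*=-(\tilde E_k^{-1}\tilde c_k)_i\,a_k(x_k-\bar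 x_k)-(\bar E_k^{-1}\bar c_k)_i\,\bar a_k\bar x_k,\qquad i\in\mathcal I,\ k\in\{0,\dots,N-1\},$$ where $$\tilde c_{ik}=\frac{\left(\frac{\alpha_{i,k+1}b_{ik}m_{k+1,2o}}{r_{ik}}\right)^{1/(2o-1)}}{1+\left(\frac{\alpha_{i,k+1}b_{ik}m_{k+1,2o}}{r_{ik}}\right)^{1/(2o-1)}b_{ik}},\qquad \bar c_{ik}=\frac{\left(\frac{\bar\alpha_{i,k+1}\bar b_{ik}}{\bar r_{ik}}\right)^{1/(2p-1)}}{1+\left(\frac{\bar\alpha_{i,k+1}\bar b_{ik}}{\bar r_{ik}}\right)^{1/(2p-1)}\bar b_{ik}},$$ $\tilde c_k=(\tilde c_{ik})_{i\in\mathcal I}$, $\bar c_k=(\bar c_{ik})_{i\in\mathcal I}$, $\tilde E_k,\bar E_k$ are the $I\times I$ matrices with $\tilde e_{ii,k}=\bar e_{ii,k}=1$ and, for $j\neq i$, $\tilde e_{ij,k}=\tilde c_{ik}b_{jk}$, $\bar e_{ij,k}=\bar c_{ik}\bar b_{jk}$, and where $\alpha_{ik},\bar\alpha_{ik}$ solve the backward recursive equations, for $k=N-1,\dots,0$, $$\bar\alpha_{ik}=\bar q_{ik}+\bar r_{ik}\left((\bar E_k^{-1}\bar c_k)_i\,\bar a_k\right)^{2p}+\bar\alpha_{i,k+1}\left(\bar a_k-\sum_{j\in\mathcal I}(\bar E_k^{-1}\bar c_k)_j\,\bar a_k\bar b_{jk}\right)^{2p},$$ $$\alpha_{ik}=q_{ik}+r_{ik}\left((\tilde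 E_k^{-1}\tilde c_k)_i\,a_k\right)^{2o}+\alpha_{i,k+1}\left(a_k-\sum_{j\in\mathcal I}(\tilde E_k^{-1}\tilde c_k)_j\,a_kb_{jk}\right)^{2o},$$ with terminal conditions $\bar\alpha_{iN}=\bar q_{iN}$ and $\alpha_{iN}=q_{iN}$.
   Context: $(2o-1)$-th and $(2p-1)$-th roots are real (odd) roots. The control set of each agent at each step is $\mathbb R$; a strategy of agent $i$ is a sequence $(u_{ik})_{k=0}^{N-1}$ of Lebesgue measurable state-and-mean-field-type feedback maps, $u_{ik}=u_{ik}(x_k,\bar x_k)\in\mathbb R$. ''Equilibrium'' means state-and-mean-field-type feedback Nash equilibrium: a profile $(u_i^* )_{i\in\mathcal I}$ of such strategies such that, for every $i\in\mathcal I$, when all agents $j\neq i$ use the feedback strategies $u_j^*$, the strategy $u_i^*$ minimizes $\mathbb E[L_i(x_0,u)]$ over all strategies of agent $i$.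
   Formalization: The last term of the recursion for α_{ik} carries the factor m_{k+1,2o} (false without it); ε_0,…,ε_N are assumed mutually independent with finite 2o-th moments, x_0 integrable; deviations must give integrable states and controls, with u_{ik} measurable with respect to x_k. *)

(* Defs.v *)
From HB Require Import structures.
From mathcomp Require Export all_boot all_order all_algebra.
From mathcomp Require Export all_classical all_reals all_analysis.
From mathcomp Require Export measurable_realfun.

Set Implicit Arguments.
Unset Strict Implicit.
Unset Printing Implicit Defensive.

Import Order.TTheory GRing.Theory Num.Theory.
Import numFieldNormedType.Exports.

Local Open Scope classical_set_scope.
Local Open Scope ring_scope.

(* The real m-th root, for odd m : the sign is carried over. *)
Definition odd_root (R : realType) (m : nat) (y : R) : R :=
  Num.sg y * (`|y| `^ (m%:R^-1)).

Definition mean d (T : measurableType d) (R : realType) (P : probability T R)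
    (X : T -> R) : R :=
  fine 'E_P[X].

(* Valued in \bar R: the moment is +oo when it diverges. *)
Definition central_moment d (T : measurableType d) (R : realType)
    (P : probability T R) (m : nat) (X : T -> R) : \bar R :=
  'E_P[fun w => (X w - mean P X) ^+ m].

Definition rv_sigma_algebra d (T : measurableType d) (R : realType)
    (X : T -> R) : set (set T) :=
  preimage_set_system setT X measurable.

Definition mutually_independent d (T : measurableType d) (R : realType)
    (P : probability T R) (N : nat) (eps : nat -> {RV P >-> R}) : Prop :=
  forall B : nat -> set R, (forall k, measurable (B k)) ->
    P (\bigcap_(k in [set k | (k <= N)%N]) (eps k @^-1` B k)) =
    (\prod_(k < N.+1) P (eps k @^-1` B k))%E.

Definition independent_of_process d (T : measurableType d) (R : realType)
    (P : probability T R) (N : nat) (X : {RV P >-> R})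
    (eps : nat -> {RV P >-> R}) : Prop :=
  forall A C : set T,
    rv_sigma_algebra X A ->
    <<s \bigcup_(k in [set k | (k <= N)%N]) rv_sigma_algebra (eps k) >> C ->
    P (A `&` C) = (P A * P C)%E.

(* A strategy sends the stage k, the state x_k and its mean to a control. *)
Definition strategy (R : realType) : Type := nat -> R -> R -> R.

(* Measurability for the completion of the Borel sigma-algebra of the plane
   under the two-dimensional Lebesgue measure. *)
Definition lebesgue_measurable_strategy (R : realType) (N : nat)
    (v : strategy R) : Prop :=
  forall k, (k < N)%N -> forall B : set R, measurable B ->
    completed_algebra_gen
      ((@lebesgue_measure R \x @lebesgue_measure R)%E)
      ((fun y : R * R => v k y.1 y.2) @^-1` B).

Definition control d (T : measurableType d) (R : realType)
    (P : probability T R) (v : strategy R) (k : nat) (x : T -> R) : T -> R :=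
  fun w => v k (x w) (mean P x).

Fixpoint state d (T : measurableType d) (R : realType) (P : probability T R)
    (n : nat) (eps : nat -> {RV P >-> R}) (x0 : {RV P >-> R})
    (a abar : nat -> R) (b bbar : 'I_n -> nat -> R)
    (u : 'I_n -> strategy R) (k : nat) : T -> R :=
  if k is k'.+1 then
    let x := state eps x0 a abar b bbar u k' in
    let c i := control P (u i) k' x in
    fun w =>
      (abar k' * mean P x + \sum_(i < n) bbar i k' * mean P (c i))
      + (a k' * (x w - mean P x)
         + \sum_(i < n) b i k' * (c i w - mean P (c i))) * eps k'.+1 w
  else x0.

(* The closed loop makes sense: all the states and controls are random
   variables with a finite mean, and the control at stage k is measurable with
   respect to the sigma-algebra of x_k.  The latter is automatic for Borel
   strategies; a Lebesgue measurable function of a random variable, however,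
   need not even be a random variable. *)
Definition well_posed d (T : measurableType d) (R : realType)
    (P : probability T R) (n N : nat) (eps : nat -> {RV P >-> R})
    (x0 : {RV P >-> R}) (a abar : nat -> R) (b bbar : 'I_n -> nat -> R)
    (u : 'I_n -> strategy R) : Prop :=
  let x := state eps x0 a abar b bbar u in
  (forall k, (k <= N)%N -> P.-integrable setT (EFin \o x k)) /\
  (forall i k, (k < N)%N ->
     P.-integrable setT (EFin \o control P (u i) k (x k)) /\
     rv_sigma_algebra (control P (u i) k (x k)) `<=` rv_sigma_algebra (x k)).

Definition cost d (T : measurableType d) (R : realType) (P : probability T R)
    (n N o p : nat) (eps : nat -> {RV P >-> R}) (x0 : {RV P >-> R})
    (a abar : nat -> R) (b bbar q qbar r rbar : 'I_n -> nat -> R)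
    (u : 'I_n -> strategy R) (i : 'I_n) : \bar R :=
  let x := state eps x0 a abar b bbar u in
  let c k := control P (u i) k (x k) in
  ((q i N)%:E * central_moment P (2 * o) (x N)
   + ((qbar i N * mean P (x N) ^+ (2 * p))%R)%:E
   + \sum_(k < N)
       ((q i k)%:E * central_moment P (2 * o) (x k)
        + ((qbar i k * mean P (x k) ^+ (2 * p))%R)%:E
        + (r i k)%:E * central_moment P (2 * o) (c k)
        + ((rbar i k * mean P (c k) ^+ (2 * p))%R)%:E))%E.

Definition deviate (R : realType) (n : nat) (u : 'I_n -> strategy R)
    (i : 'I_n) (v : strategy R) : 'I_n -> strategy R :=
  fun j => if j == i then v else u j.

Definition feedback_nash_equilibrium d (T : measurableType d) (R : realType)
    (P : probability T R) (n N o p : nat) (eps : nat -> {RV P >-> R})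
    (x0 : {RV P >-> R}) (a abar : nat -> R)
    (b bbar q qbar r rbar : 'I_n -> nat -> R)
    (u : 'I_n -> strategy R) : Prop :=
  [/\ forall i, lebesgue_measurable_strategy N (u i),
      well_posed N eps x0 a abar b bbar u
    & forall i (v : strategy R),
        lebesgue_measurable_strategy N v ->
        well_posed N eps x0 a abar b bbar (deviate u i v) ->
        (cost N o p eps x0 a abar b bbar q qbar r rbar u i <=
         cost N o p eps x0 a abar b bbar q qbar r rbar (deviate u i v) i)%E].

(* With s the odd m-th root of y: s / (1 + s b). *)
Definition response (R : realType) (m : nat) (y b : R) : R :=
  odd_root m y / (1 + odd_root m y * b).

Definition coupling_mx (R : realType) (n : nat) (c : 'cV[R]_n)
    (b : 'I_n -> R) : 'M[R]_n :=
  \matrix_(i, j) (if i == j then 1 else c i 0 * b j).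

Definition noise_moment d (T : measurableType d) (R : realType)
    (P : probability T R) (eps : nat -> {RV P >-> R}) (m k : nat) : R :=
  fine 'E_P[fun w => eps k w ^+ m].

(* mom k stands for E[eps_k ^ 2o]. *)
Definition c_tilde (R : realType) (n o : nat) (mom : nat -> R)
    (b r alpha : 'I_n -> nat -> R) (k : nat) : 'cV[R]_n :=
  \col_i response (2 * o - 1) (alpha i k.+1 * b i k * mom k.+1 / r i k) (b i k).

Definition c_bar (R : realType) (n p : nat)
    (bbar rbar alphabar : 'I_n -> nat -> R) (k : nat) : 'cV[R]_n :=
  \col_i response (2 * p - 1)
           (alphabar i k.+1 * bbar i k / rbar i k) (bbar i k).

Definition E_tilde (R : realType) (n o : nat) (mom : nat -> R)
    (b r alpha : 'I_n -> nat -> R) (k : nat) : 'M[R]_n :=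
  coupling_mx (c_tilde o mom b r alpha k) (fun j => b j k).

Definition E_bar (R : realType) (n p : nat)
    (bbar rbar alphabar : 'I_n -> nat -> R) (k : nat) : 'M[R]_n :=
  coupling_mx (c_bar p bbar rbar alphabar k) (fun j => bbar j k).

Definition gain_tilde (R : realType) (n o : nat) (mom : nat -> R)
    (b r alpha : 'I_n -> nat -> R) (k : nat) (i : 'I_n) : R :=
  (invmx (E_tilde o mom b r alpha k) *m c_tilde o mom b r alpha k) i 0.

Definition gain_bar (R : realType) (n p : nat)
    (bbar rbar alphabar : 'I_n -> nat -> R) (k : nat) (i : 'I_n) : R :=
  (invmx (E_bar p bbar rbar alphabar k) *m c_bar p bbar rbar alphabar k) i 0.

Definition solves_alpha_bar (R : realType) (n N p : nat) (abar : nat -> R)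
    (bbar qbar rbar alphabar : 'I_n -> nat -> R) : Prop :=
  let g := gain_bar p bbar rbar alphabar in
  (forall i, alphabar i N = qbar i N) /\
  (forall i k, (k < N)%N ->
     alphabar i k = qbar i k + rbar i k * (g k i * abar k) ^+ (2 * p)
       + alphabar i k.+1
         * (abar k - \sum_(j < n) g k j * abar k * bbar j k) ^+ (2 * p)).

(* The factor mom k.+1 in the continuation term, the same as in c_tilde, comes
   from E[(x_{k+1} - E x_{k+1})^2o] = mom_{k+1} E[(...)^2o], the noise being
   multiplicative and independent of x_k.  The version of this recursion without
   the factor agrees with it when mom = 1, but does not describe an equilibrium
   in general. *)
Definition solves_alpha (R : realType) (n N o : nat) (mom a : nat -> R)
    (b q r alpha : 'I_n -> nat -> R) : Prop :=
  let g := gain_tilde o mom b r alpha in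
  (forall i, alpha i N = q i N) /\
  (forall i k, (k < N)%N ->
     alpha i k = q i k + r i k * (g k i * a k) ^+ (2 * o)
       + alpha i k.+1 * mom k.+1
         * (a k - \sum_(j < n) g k j * a k * b j k) ^+ (2 * o)).

(* Main.v *)
From HB Require Import structures.
Require Import Defs.
From mathcomp Require Import ring lra.
Set Implicit Arguments.
Unset Strict Implicit.
Unset Printing Implicit Defensive.
Import Order.TTheory GRing.Theory Num.Theory.
Local Open Scope classical_set_scope.
Local Open Scope ring_scope.

(** The proof is dynamic programming with the value function
      V_k = alpha_k E[(x_k - xbar_k)^2o] + alphabar_k xbar_k^2p.
    Fix an agent i and any admissible profile in which the other agents play the
    announced feedback.  Then V_k <= (stage cost at k) + V_(k+1), with equality
    when agent i plays the feedback as well ([value_le], [value_eq]).  Summing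
    over k bounds the cost of agent i below by V_0, which the feedback attains,
    and V_0 depends on x_0 only.  All of this takes place in the extended reals,
    so divergent moments need no separate treatment: the moments are nonnegative
    and nothing is ever subtracted.

    The one-stage inequality splits into a part on the means and a part on the
    centered variables.  The centered state x_(k+1) - xbar_(k+1) has the form
    Y eps with eps independent of Y and of mean zero, so its moment of order 2o
    is E[eps^2o] E[Y^2o]; hence the factor E[eps^2o] in the recursion for
    alpha.  After this substitution the centered inequality is the integral of
    a pointwise one, which has the same shape as the inequality on the means,
    where the moment is replaced by 1.  So a single deterministic inequality
    ([stage_cost_le]) serves for both, and the bar quantities are the tilde
    quantities of moment 1 ([gain_bar_tilde], [solves_alpha_bar_tilde]).

    That inequality is convexity.  Let y be the centered state (or the mean),
    s_i the odd root of beta_i b_i / r_i, with beta_i the coefficient of the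
    cost to go, and S = sum_j g_j b_j.  The linear system E g = c says
    g_i = s_i (1 - S) ([coupling_gainE]).  So the closed loop is
    z = a (1 - S) y, the control of agent i is - s_i z, and the first order
    condition of the convex cost r u^2o + beta (z + b (u + s z))^2o at u = - s z
    reads r s^(2o-1) = beta b, the definition of s ([best_reply]).
    Invertibility of E comes from s_i b_i >= 0 ([coupling_mx_unit]).

    The independence of Y and eps_(k+1) has to be derived for arbitrary
    admissible deviations: Y is measurable for the sigma-algebra generated by
    x_0 and eps_0, ..., eps_k, and the pi-lambda theorem on cylinders makes that
    sigma-algebra independent of eps_(k+1) ([past_independent]). *)

(** * Convexity of even powers *)

(** The induction step multiplies by y and adds (n + 1) z^n (y - z)^2 >= 0. *)
Lemma ge0_tangent_exprn (R : realFieldType) (n : nat) (y z : R) :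
  0 <= y -> 0 <= z -> n.+1%:R * (z ^+ n * y) <= y ^+ n.+1 + n%:R * z ^+ n.+1.
Proof.
move=> y0 z0; elim: n => [|n IHn]; first by rewrite mul0r addr0 !mul1r.
have zn : 0 <= z ^+ n by rewrite exprn_ge0.
have sq : 0 <= n.+1%:R * (z ^+ n * (y - z) ^+ 2).
  by rewrite mulr_ge0 // mulr_ge0 // sqr_ge0.
have := lerD (ler_wpM2l y0 IHn) sq; rewrite !exprS -!natr1 => H; nra.
Qed.

(** An even power only sees absolute values, and passing to them can only
    increase z^(2p-1) y; this reduces to the nonnegative case. *)
Lemma tangent_exprn_even (R : realFieldType) (p : nat) (y z : R) : (0 < p)%N ->
  (2 * p)%:R * (z ^+ (2 * p - 1) * (y - z)) <= y ^+ (2 * p) - z ^+ (2 * p).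
Proof.
move=> p0; set n := (2 * p - 1)%N.
have e2p : (2 * p)%N = n.+1 by rewrite /n subn1 prednK // muln_gt0.
have absX (t : R) : `|t| ^+ (2 * p) = t ^+ (2 * p).
  by rewrite !exprM real_normK ?num_real.
have := @ge0_tangent_exprn R n `|y| `|z| (normr_ge0 _) (normr_ge0 _).
rewrite -e2p !absX => H.
have : z ^+ n * y <= `|z| ^+ n * `|y| by rewrite -normrX -normrM ler_norm.
rewrite -(@ler_pM2l _ (2 * p)%:R) ?ltr0n ?muln_gt0 // => /le_trans /(_ H) {}H.
by rewrite mulrBr -exprSr -e2p mulrBr {2}e2p -natr1; lra.
Qed.

(** The first order condition makes the two linear terms of the tangent
    inequalities at u = - s z and at z cancel. *)
Lemma best_reply (R : realFieldType) (p : nat) (r s beta b z u : R) :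
  (0 < p)%N -> 0 <= r -> 0 <= beta -> r * s ^+ (2 * p - 1) = beta * b ->
  r * (s * z) ^+ (2 * p) + beta * z ^+ (2 * p) <=
  r * u ^+ (2 * p) + beta * (z + b * (u + s * z)) ^+ (2 * p).
Proof.
move=> p0 r0 beta0 foc.
have oddN (t : R) : (- t) ^+ (2 * p - 1) = - t ^+ (2 * p - 1).
  by rewrite exprNn -signr_odd oddB ?muln_gt0 //= mul2n odd_double mulN1r.
have := ler_wpM2l r0 (tangent_exprn_even u (- (s * z)) p0).
have := ler_wpM2l beta0 (tangent_exprn_even (z + b * (u + s * z)) z p0).
rewrite oddN [(- (s * z)) ^+ (2 * p)]exprM sqrrN -exprM exprMn opprK.
have -> : z + b * (u + s * z) - z = b * (u + s * z) by ring.
set Z := z ^+ (2 * p - 1); set S := s ^+ _ in foc *.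
set m := (2 * p)%:R.
have -> : beta * (m * (Z * (b * (u + s * z)))) =
  m * Z * (u + s * z) * (beta * b).
  by ring.
rewrite -foc => h1 h2.
have : r * (m * (- (S * Z) * (u + s * z))) + m * Z * (u + s * z) * (r * S) = 0.
  by ring.
lra.
Qed.

(** * The coupled best replies *)

Section root.
Variables (R : realType) (m : nat).
Hypothesis m_odd : odd m.

Lemma odd_rootK (y : R) : odd_root m y ^+ m = y.
Proof.
have m0 : (0 < m)%N by case: m m_odd.
rewrite /odd_root exprMn.
rewrite -[X in _ * X]powR_mulrn ?powR_ge0 // -powRrM.
rewrite mulVf ?pnatr_eq0 ?lt0n_neq0 // powRr1 //.
suff -> : Num.sg y ^+ m = Num.sg y by rewrite -numEsg.
case: sgrP => _; first by rewrite expr0n eqn0Ngt m0.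
  by rewrite expr1n.
by rewrite -signr_odd m_odd expr1.
Qed.

Lemma odd_root_mulr_ge0 (beta b : R) :
  0 <= beta -> 0 <= odd_root m (beta * b) * b.
Proof.
move=> beta0; rewrite /odd_root sgrM mulrAC.
rewrite mulr_ge0 ?powR_ge0 // -mulrA -normrEsg mulr_ge0 //.
by rewrite sgr_ge0.
Qed.
End root.

Section coupling.
Variables (R : realType) (n m : nat) (beta b : 'I_n -> R).
Hypothesis beta0 : forall i, 0 <= beta i.

Let s i := odd_root m (beta i * b i).
Let c : 'cV[R]_n := \col_i response m (beta i * b i) (b i).

Let sb0 i : 0 <= s i * b i. Proof. exact: odd_root_mulr_ge0. Qed.
Let t0 i : 1 + s i * b i != 0.
Proof. by rewrite lt0r_neq0 // ltr_pwDl. Qed.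
Let cE i : (1 + s i * b i) * c i 0 = s i.
Proof. by rewrite mxE /response mulrCA divff ?mulr1 ?t0. Qed.

(** The matrix is diag(1 - c_i b_i) + c b^T with 1 - c_i b_i = (1 + s_i b_i)^-1.
    A row vector v in its kernel is therefore determined by kappa = v c, and
    kappa (1 + sum_j s_j b_j) = 0 forces kappa = 0 as s_j b_j >= 0. *)
Lemma coupling_mx_unit : coupling_mx c b \in unitmx.
Proof.
rewrite -row_free_unit; apply: inj_row_free => v v0.
pose kappa := \sum_i v 0 i * c i 0.
have vE j : v 0 j = - (kappa * (b j * (1 + s j * b j))).
  have := congr1 (fun A : 'rV_n => A 0 j) v0; rewrite !mxE.
  under eq_bigr => i _ do rewrite mxE.
  rewrite (bigD1 j) //= eqxx mulr1.
  rewrite (eq_bigr (fun i => v 0 i * c i 0 * b j)); last first.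
    by move=> i /negbTE ->; rewrite mulrA.
  rewrite -mulr_suml => H.
  have : v 0 j * (1 - c j 0 * b j) + kappa * b j = 0.
    by rewrite -[RHS]H /kappa [in LHS](bigD1 j) //=; ring.
  move=> /(congr1 (fun x => x * (1 + s j * b j))); rewrite mul0r.
  have -> : (v 0 j * (1 - c j 0 * b j) + kappa * b j) * (1 + s j * b j) =
    v 0 j * (1 + s j * b j - ((1 + s j * b j) * c j 0) * b j)
      + kappa * (b j * (1 + s j * b j)) by ring.
  by rewrite cE addrK mulr1 => /eqP; rewrite addr_eq0 => /eqP.
have kappaE : kappa = - (kappa * \sum_j s j * b j).
  rewrite {1}/kappa mulr_sumr -sumrN; apply: eq_bigr => j _.
  rewrite vE -[in RHS](cE j); ring.
have : kappa * (1 + \sum_j s j * b j) = 0.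
  by rewrite mulrDr mulr1 {1}kappaE addNr.
move/eqP; rewrite mulf_eq0 [X in _ || X]gt_eqF ?orbF; last first.
  by rewrite ltr_pwDl // sumr_ge0.
move=> /eqP kappa0; apply/rowP => j.
by rewrite vE kappa0 mul0r oppr0 mxE.
Qed.

(** Row i of E g = c, multiplied by 1 + s_i b_i: the gain of each agent is its
    reply s_i to the closed loop that all the gains produce together. *)
Lemma coupling_gainE (g := invmx (coupling_mx c b) *m c) i :
  g i 0 = s i * (1 - \sum_j g j 0 * b j).
Proof.
have : (coupling_mx c b *m g) i 0 = c i 0 by rewrite mulKVmx ?coupling_mx_unit.
rewrite mxE (bigD1 i) //= [coupling_mx _ _ _ _]mxE eqxx mul1r.
rewrite (eq_bigr (fun j => c i 0 * (g j 0 * b j))); last first.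
  move=> j ji; rewrite [coupling_mx _ _ _ _]mxE eq_sym (negbTE ji).
  by rewrite mulrAC mulrA.
rewrite -mulr_sumr => H.
have : g i 0 * (1 - c i 0 * b i) + c i 0 * \sum_j g j 0 * b j = c i 0.
  by rewrite -[RHS]H [in LHS](bigD1 i) //=; ring.
move=> /(congr1 (fun x => (1 + s i * b i) * x)).
set S := \sum_j _.
have -> : (1 + s i * b i) * (g i 0 * (1 - c i 0 * b i) + c i 0 * S) =
  g i 0 * (1 + s i * b i - ((1 + s i * b i) * c i 0) * b i)
   + ((1 + s i * b i) * c i 0) * S by ring.
by rewrite cE addrK mulr1 => gE; rewrite mulrBr mulr1 -[X in _ = X - _]gE addrK.
Qed.
End coupling.

(** * Cost and value at one stage *)

Section stage.
Variables (R : realFieldType) (n p : nat) (A q r beta y : R).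
Variables (b g s v : 'I_n -> R) (i : 'I_n).

Let S := \sum_j g j * b j.

Let loopE : A - \sum_j g j * A * b j = A * (1 - S).
Proof.
rewrite mulrBr mulr1 /S mulr_sumr; congr (_ - _).
by apply: eq_bigr => j _; ring.
Qed.

(** This is [best_reply] at z = A (1 - S) y: since g_i = s_i (1 - S), replacing
    - g_i A y by v_i moves the closed loop from z to z + b_i (v_i + s_i z). *)
Lemma stage_cost_le : (0 < p)%N -> 0 <= r -> 0 <= beta ->
  g i = s i * (1 - S) -> r * s i ^+ (2 * p - 1) = beta * b i ->
  (forall j, j != i -> v j = - g j * A * y) ->
  (q + r * (g i * A) ^+ (2 * p)
     + beta * (A - \sum_j g j * A * b j) ^+ (2 * p)) * y ^+ (2 * p) <=
  q * y ^+ (2 * p) + r * v i ^+ (2 * p)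
     + beta * (A * y + \sum_j b j * v j) ^+ (2 * p).
Proof.
move=> p0 r0 beta0 gE foc vE; rewrite loopE.
have -> : A * y + \sum_j b j * v j =
    A * (1 - S) * y + b i * (v i + s i * (A * (1 - S) * y)).
  have -> : s i * (A * (1 - S) * y) = g i * A * y by rewrite gE; ring.
  rewrite /S (bigD1 i) //= [in RHS](bigD1 i) //=.
  rewrite (eq_bigr (fun j => - (A * y) * (g j * b j))) => [|j ji].
    rewrite -mulr_sumr; ring.
  by rewrite vE //; ring.
have -> : g i * A = s i * (A * (1 - S)) by rewrite gE; ring.
have := @best_reply R p r (s i) beta (b i) (A * (1 - S) * y) (v i)
  p0 r0 beta0 foc.
rewrite !mulrA !exprMn; lra.
Qed.

Lemma stage_cost_eq : (forall j, v j = - g j * A * y) ->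
  (q + r * (g i * A) ^+ (2 * p)
     + beta * (A - \sum_j g j * A * b j) ^+ (2 * p)) * y ^+ (2 * p) =
  q * y ^+ (2 * p) + r * v i ^+ (2 * p)
     + beta * (A * y + \sum_j b j * v j) ^+ (2 * p).
Proof.
move=> vE.
have -> : A * y + \sum_j b j * v j = (A - \sum_j g j * A * b j) * y.
  rewrite mulrBl mulr_suml -sumrN; congr (_ + _).
  by apply: eq_bigr => j _; rewrite vE; ring.
have -> : v i = - (g i * A * y) by rewrite vE; ring.
rewrite [(- _) ^+ _]exprM sqrrN -exprM !exprMn; ring.
Qed.
End stage.

Lemma exprn2_ge0 (R : realDomainType) (t : R) m : 0 <= t ^+ (2 * m).
Proof. by rewrite exprM exprn_ge0 // sqr_ge0. Qed.

Section gains.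
Variables (R : realType) (n N o : nat) (mom a : nat -> R).
Variables (b q r alpha : 'I_n -> nat -> R).
Hypotheses (ho : (1 <= o)%N) (mom0 : forall k, 0 <= mom k)
  (hq : forall i k, (k <= N)%N -> 0 < q i k)
  (hr : forall i k, (k < N)%N -> 0 < r i k)
  (halpha : solves_alpha N o mom a b q r alpha).

Let g := gain_tilde o mom b r alpha.

Lemma alpha_ge0 i k : (k <= N)%N -> 0 <= alpha i k.
Proof.
have [endE recE] := halpha.
move: {2}(N - k)%N (erefl (N - k)%N) => m; elim: m k => [|m IHm] k mE kN.
  have -> : k = N by apply/eqP; rewrite eqn_leq kN -subn_eq0 mE.
  by rewrite endE ltW // hq.
have kN' : (k < N)%N by rewrite -subn_gt0 mE.
have := IHm k.+1; rewrite subnS mE => /(_ erefl kN') a0.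
rewrite recE // !addr_ge0 //.
- by rewrite ltW // hq.
- by rewrite mulr_ge0 ?exprn2_ge0 // ltW // hr.
- by rewrite !mulr_ge0 ?exprn2_ge0.
Qed.

Section one_stage.
Variables (k : nat) (kN : (k < N)%N).

Let beta i := alpha i k.+1 * mom k.+1 / r i k.

Let beta0 i : 0 <= beta i.
Proof. by rewrite !mulr_ge0 ?alpha_ge0 // invr_ge0 ltW // hr. Qed.

Let odd_deg : odd (2 * o - 1).
Proof. by rewrite oddB ?muln_gt0 //= mul2n odd_double. Qed.

Let c_tildeE : c_tilde o mom b r alpha k =
  \col_i response (2 * o - 1) (beta i * b i k) (b i k).
Proof.
apply/colP => i; rewrite !mxE; congr response; rewrite /beta.
by rewrite [alpha i k.+1 * b i k * _]mulrAC [LHS]mulrAC.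
Qed.

Lemma E_tilde_unit : E_tilde o mom b r alpha k \in unitmx.
Proof. by rewrite /E_tilde c_tildeE coupling_mx_unit. Qed.

(** One step of the dynamic programming recursion before expectations are taken:
    y and v are values of the centered state and controls, and mom is the factor
    that the noise contributes; on the means, y and v are means and mom is 1. *)
Lemma alpha_cost_le i (y : R) (v : 'I_n -> R) :
  (forall j, j != i -> v j = - g k j * a k * y) ->
  alpha i k * y ^+ (2 * o) <= q i k * y ^+ (2 * o) + r i k * v i ^+ (2 * o)
    + alpha i k.+1 * mom k.+1 * (a k * y + \sum_j b j k * v j) ^+ (2 * o).
Proof.
move=> vE; rewrite (halpha.2 i k kN).
apply: (@stage_cost_le R n o _ _ _ _ _ _ _
  (fun j => odd_root (2 * o - 1) (beta j * b j k))) => //.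
- by rewrite ltW // hr.
- by rewrite mulr_ge0 ?alpha_ge0.
- by rewrite /g /gain_tilde /E_tilde c_tildeE coupling_gainE.
- rewrite odd_rootK // /beta mulrA [r i k * _]mulrC mulfVK //.
  by rewrite gt_eqF // hr.
Qed.

Lemma alpha_cost_eq i (y : R) (v : 'I_n -> R) :
  (forall j, v j = - g k j * a k * y) ->
  alpha i k * y ^+ (2 * o) = q i k * y ^+ (2 * o) + r i k * v i ^+ (2 * o)
    + alpha i k.+1 * mom k.+1 * (a k * y + \sum_j b j k * v j) ^+ (2 * o).
Proof. by move=> vE; rewrite (halpha.2 i k kN); exact: stage_cost_eq. Qed.
End one_stage.
End gains.

Section unit_moment.
Variables (R : realType) (n N p : nat) (abar : nat -> R).
Variables (bbar qbar rbar alphabar : 'I_n -> nat -> R).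

Lemma c_bar_tilde k : c_bar p bbar rbar alphabar k =
  c_tilde p (fun=> 1) bbar rbar alphabar k.
Proof. by apply/colP => i; rewrite !mxE mulr1. Qed.

Lemma gain_bar_tilde : gain_bar p bbar rbar alphabar =
  gain_tilde p (fun=> 1) bbar rbar alphabar.
Proof.
by apply/funext => k; apply/funext => i; rewrite /gain_bar /E_bar c_bar_tilde.
Qed.

Lemma solves_alpha_bar_tilde :
  solves_alpha_bar N p abar bbar qbar rbar alphabar ->
  solves_alpha N p (fun=> 1) abar bbar qbar rbar alphabar.
Proof.
rewrite /solves_alpha_bar gain_bar_tilde => -[endE recE].
by split=> [//|i k kN /=]; rewrite (mulr1 (alphabar i k.+1)); exact: recE.
Qed.
End unit_moment.

(** * Products of independent random variables *)

Definition independent_rv d (T : measurableType d) (R : realType)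
    (P : probability T R) (X Y : T -> R) : Prop :=
  forall A B, measurable A -> measurable B ->
    P (X @^-1` A `&` Y @^-1` B) = (P (X @^-1` A) * P (Y @^-1` B))%E.

Section product_law.
Context d (T : measurableType d) (R : realType) (P : probability T R).
Variables (X Y : {RV P >-> R}).
Hypothesis XY : independent_rv P X Y.

Let pairXY (w : T) : R * R := (X w, Y w).
Let mpairXY : measurable_fun setT pairXY.
Proof. by apply/measurable_fun_pair. Qed.
HB.instance Definition _ := isMeasurableFun.Build _ _ _ _ pairXY mpairXY.

(** Independence is the agreement of the two laws on rectangles, and rectangles
    determine a finite measure on the plane. *)
Lemma joint_lawE (A : set (R * R)) : measurable A ->
  (distribution P X \x distribution P Y)%E A = distribution P pairXY A.
Proof.
apply: product_measure_unique => B C mB mC.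
by rewrite /distribution /pushforward/= -XY.
Qed.

(** No integrability is assumed, so this also covers infinite moments, with
    0 * oo = 0 when one of the factors vanishes almost surely. *)
Lemma ge0_independent_integralM (f g : R -> R) :
  measurable_fun setT f -> measurable_fun setT g ->
  (forall x, 0 <= f x) -> (forall y, 0 <= g y) ->
  (\int[P]_w (f (X w) * g (Y w))%:E =
   (\int[P]_w (f (X w))%:E) * (\int[P]_w (g (Y w))%:E))%E.
Proof.
move=> mf mg f0 g0.
pose h (z : R * R) := (f z.1 * g z.2)%:E.
have mh : measurable_fun setT h.
  by apply/measurable_EFinP/measurable_funM; exact: measurableT_comp.
have h0 z : (0 <= h z)%E by rewrite lee_fin mulr_ge0.
have mEf : measurable_fun setT (EFin \o f) by exact/measurable_EFinP.
have mEg : measurable_fun setT (EFin \o g) by exact/measurable_EFinP.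
transitivity (\int[distribution P pairXY]_z h z)%E.
  by rewrite ge0_integral_distribution.
transitivity (\int[(distribution P X \x distribution P Y)%E]_z h z)%E.
  by apply: eq_measure_integral => A mA _; exact/esym/joint_lawE.
rewrite fubini_tonelli1 // /fubini_F.
transitivity (\int[distribution P X]_x
    ((f x)%:E * \int[distribution P Y]_y (g y)%:E))%E.
  apply: eq_integral => x _; rewrite -ge0_integralZl //; last 2 first.
  - by move=> y _; rewrite lee_fin.
  - by rewrite lee_fin.
rewrite ge0_integralZr //; last 2 first.
- by move=> x _; rewrite lee_fin.
- by apply: integral_ge0 => y _; rewrite lee_fin.
by rewrite !ge0_integral_distribution // => ?; rewrite lee_fin.
Qed.

Hypotheses (iX : P.-integrable setT (EFin \o X))
           (iY : P.-integrable setT (EFin \o Y)).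

Lemma independent_integrableM : P.-integrable setT (fun w => (X w * Y w)%:E).
Proof.
apply/integrableP; split.
  by apply/measurable_EFinP/measurable_funM.
under eq_integral => w _ do rewrite abse_EFin normrM.
rewrite (ge0_independent_integralM (f := Num.norm) (g := Num.norm)) //.
have /integrableP[_ hX] := iX; have /integrableP[_ hY] := iY.
apply: lte_mul_pinfty; last exact: hY.
  by apply: integral_ge0.
by rewrite ge0_fin_numE //; apply: integral_ge0.
Qed.

Lemma independent_integralM :
  (\int[P]_w (X w * Y w)%:E = (\int[P]_w (X w)%:E) * (\int[P]_w (Y w)%:E))%E.
Proof.
pose h (z : R * R) := (z.1 * z.2)%:E.
have mh : measurable_fun setT h.
  by apply/measurable_EFinP/measurable_funM.
have ih : P.-integrable setT (h \o pairXY) := independent_integrableM.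
transitivity (\int[distribution P pairXY]_z h z)%E.
  by rewrite integral_distribution.
transitivity (\int[(distribution P X \x distribution P Y)%E]_z h z)%E.
  by apply: eq_measure_integral => A mA _; exact/esym/joint_lawE.
have prodi : (distribution P X \x distribution P Y)%E.-integrable setT h.
  apply/integrableP; split=> //.
  have /integrableP[_] := ih; apply: le_lt_trans.
  rewrite (eq_measure_integral (distribution P pairXY)); last first.
    by move=> A mA _; exact: joint_lawE.
  rewrite ge0_integral_distribution //; exact: measurableT_comp.
rewrite -integral12_prod_meas1 // /fubini_F.
have dY : (distribution P Y).-integrable setT (@EFin R).
  exact: integrable_pushforward.
have dX : (distribution P X).-integrable setT (@EFin R).
  exact: integrable_pushforward.
transitivity (\int[distribution P X]_x
    (x%:E * \int[distribution P Y]_y y%:E))%E.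
  by apply: eq_integral => x _; rewrite -integralZl.
have /fineK <- : (\int[distribution P Y]_y y%:E)%E \is a fin_num.
  exact: integrable_fin_num.
rewrite integralZr // !integral_distribution // fineK //.
exact: integrable_fin_num.
Qed.
End product_law.

(** * The information available at a stage *)

Section past.
Context d (T : measurableType d) (R : realType) (P : probability T R).
Variables (N : nat) (eps : nat -> {RV P >-> R}) (x0 : {RV P >-> R}).

(** A pi-system that generates the sigma-algebra of x_0, eps_0, ..., eps_k. *)
Definition past_cylinders (k : nat) : set (set T) :=
  [set C | exists A (B : nat -> set R),
    [/\ measurable A, forall j, measurable (B j) &
        C = x0 @^-1` A `&`
          \bigcap_(j in [set j | (j <= k)%N]) (eps j @^-1` B j)]].

Definition past_measurable (k : nat) (X : T -> R) : Prop :=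
  @measurable_fun _ _ (g_sigma_algebraType (past_cylinders k)) R setT X.

Lemma past_measurableP k (X : T -> R) :
  past_measurable k X <->
  (forall B, measurable B -> <<s past_cylinders k >> (X @^-1` B)).
Proof.
split=> [mX B mB|mX _ B mB]; last by rewrite setTI; exact: mX.
by have := mX measurableT B mB; rewrite setTI.
Qed.

(** This is how an arbitrary admissible control enters: its sigma-algebra is
    contained in that of the state, whatever the strategy. *)
Lemma past_measurable_sub k (X Y : T -> R) :
  rv_sigma_algebra Y `<=` rv_sigma_algebra X ->
  past_measurable k X -> past_measurable k Y.
Proof.
move=> YX /past_measurableP mX; apply/past_measurableP => B mB.
have [|C mC] := YX (Y @^-1` B); first by exists B => //; rewrite setTI.
by rewrite setTI => <-; exact: mX.
Qed.

Lemma past_measurable_x0 k : past_measurable k x0.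
Proof.
apply/past_measurableP => A mA; apply: sub_sigma_algebra.
exists A, (fun=> setT); split => //.
by rewrite (_ : \bigcap_(_ in _) _ = setT) ?setIT // -subTset => w _ j _.
Qed.

Lemma past_measurable_eps k : past_measurable k (eps k).
Proof.
apply/past_measurableP => A mA; apply: sub_sigma_algebra.
exists setT, (fun j => if j == k then A else setT); split => //.
  by move=> j; case: ifP.
rewrite preimage_setT setTI; apply/seteqP; split=> [w Aw j /= _|w /(_ k)/=].
  by case: eqP => [->|].
by rewrite eqxx; exact.
Qed.

Lemma past_measurableS k (X : T -> R) :
  past_measurable k X -> past_measurable k.+1 X.
Proof.
move=> /past_measurableP mX; apply/past_measurableP => C mC.
move: (mX C mC); apply: smallest_sub; first exact: smallest_sigma_algebra.
move=> _ [A [B [mA mB ->]]]; apply: sub_sigma_algebra.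
exists A, (fun j => if (j <= k)%N then B j else setT); split => //.
  by move=> j; case: ifP.
congr (_ `&` _); apply/seteqP; split=> w /= Bw j /=; last first.
  by move=> jk; have := Bw j (leqW jk); rewrite jk.
by move=> _; case: ifPn => // jk; exact: Bw.
Qed.

Let past_cylindersI k : setI_closed (past_cylinders k).
Proof.
move=> _ _ [A [B [mA mB ->]]] [A' [B' [mA' mB' ->]]].
exists (A `&` A'), (fun j => B j `&` B' j); split.
- exact: measurableI.
- by move=> j; exact: measurableI.
- rewrite setIACA preimage_setI -bigcapI; congr (_ `&` _).
Qed.

Let past_cylinders_measurable k : past_cylinders k `<=` measurable.
Proof.
move=> _ [A [B [mA mB ->]]]; apply: measurableI; first exact: measurable_funPTI.
apply: fin_bigcap_measurable; first exact: (finite_II k.+1).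
by move=> j _; exact: measurable_funPTI.
Qed.

Lemma past_measurable_fun k (X : T -> R) : past_measurable k X ->
  measurable_fun setT X.
Proof.
move=> /past_measurableP mX _ B mB; rewrite setTI.
exact: (smallest_sub (sigma_algebra_measurable T)
  (@past_cylinders_measurable k) (mX B mB)).
Qed.

Hypotheses (heps : mutually_independent N eps)
           (hx0 : independent_of_process N x0 eps).

Let measure_cylinder A (B : nat -> set R) :
  measurable A -> (forall j, measurable (B j)) ->
  P (x0 @^-1` A `&` \bigcap_(j in [set j | (j <= N)%N]) (eps j @^-1` B j)) =
  (P (x0 @^-1` A) * \prod_(j < N.+1) P (eps j @^-1` B j))%E.
Proof.
move=> mA mB; rewrite -heps //; apply: hx0.
  by exists A => //; rewrite setTI.
set G := \bigcup_(_ in _) _.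
apply: (@fin_bigcap_measurable _ (g_sigma_algebraType G)) => [|j jN].
  exact: (finite_II N.+1).
by apply: sub_sigma_algebra; exists j => //; exists (B j) => //; rewrite setTI.
Qed.

(** The two finite measures C |-> P (C `&` D) and C |-> P D * P C, with D an
    event on eps_(k+1), agree on the cylinders, hence on what they generate. *)
Lemma past_independent k (X : T -> R) : (k < N)%N ->
  past_measurable k X -> independent_rv P X (eps k.+1).
Proof.
move=> kN /past_measurableP mX A B mA mB.
pose D := eps k.+1 @^-1` B.
have mD : measurable D by exact: measurable_funPTI.
have PD0 : 0 <= fine (P D) by rewrite fine_ge0.
pose m1 : {measure set T -> \bar R} := mrestr P mD.
pose m2 : {measure set T -> \bar R} := mscale (NngNum PD0) P.
have m1E C : m1 C = P (C `&` D) by [].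
have m2E C : m2 C = (P D * P C)%E.
  by rewrite /m2 /= /mscale /= fineK // fin_num_measure.
suff : m1 (X @^-1` A) = m2 (X @^-1` A) by rewrite m1E m2E muleC.
apply: (g_sigma_algebra_measure_unique
  (past_cylinders k) _ (fun=> setT) _ _ m1 m2) => //.
- move=> _; exists setT, (fun=> setT); split => //.
  rewrite preimage_setT setTI; apply/esym; rewrite -subTset => w _ j _ //.
- by rewrite bigcup_const.
- move=> C [A' [B' [mA' mB' ->]]].
  rewrite [LHS]m1E [RHS]m2E.
  (* The cylinder and its trace on D as intersections over all stages up to N,
     the form in which independence is assumed. *)
  pose B1 j := if (j <= k)%N then B' j else setT.
  pose B2 j := if j == k.+1 then B else B1 j.
  have mB1 j : measurable (B1 j) by rewrite /B1; case: ifP.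
  have mB2 j : measurable (B2 j) by rewrite /B2; case: ifP.
  have B2k : B2 k.+1 = B by rewrite /B2 eqxx.
  have B1k : B1 k.+1 = setT by rewrite /B1 ltnn.
  have B2E j : j != k.+1 -> B2 j = B1 j by rewrite /B2 => /negbTE ->.
  set F := \bigcap_(_ in _) _.
  have cyl1 : F = \bigcap_(j in [set j | (j <= N)%N]) (eps j @^-1` B1 j).
    apply/seteqP; split=> w /= Bw j /= jN; rewrite /B1.
      by case: ifPn => // jk; exact: Bw.
    by have := Bw j (leq_trans jN (ltnW kN)); rewrite /B1 jN.
  have cyl2 : F `&` D = \bigcap_(j in [set j | (j <= N)%N]) (eps j @^-1` B2 j).
    rewrite cyl1; apply/seteqP; split=> [w /= [Bw Dw] j /= jN|w /= Bw].
      have [->|jk] := eqVneq j k.+1; first by rewrite B2k.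
      by rewrite B2E //; exact: Bw.
    split=> [j jN|]; last first.
      by rewrite -[X in X w]/(eps k.+1 @^-1` B) -B2k; exact: Bw.
    have [->|jk] := eqVneq j k.+1; first by rewrite B1k.
    by rewrite -B2E //; exact: Bw.
  rewrite -setIA cyl2 cyl1 !measure_cylinder //.
  have kN1 : (k.+1 < N.+1)%N by [].
  pose ord := Ordinal kN1.
  rewrite [in LHS](bigD1 ord) // [in RHS](bigD1 ord) //=.
  rewrite B2k B1k preimage_setT probability_setT mul1e.
  rewrite muleCA; congr (_ * (_ * _))%E.
  by apply: eq_bigr => j jk; rewrite B2E.
- by move=> j; rewrite [m1 _]m1E ltey_eq fin_num_measure // setTI.
- exact: mX.
Qed.

End past.

(** * Means and moments along one step *)

Section affine.
Context d (T : measurableType d) (R : realType) (P : probability T R).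

Lemma integrable_measurable_fun (X : T -> R) :
  P.-integrable setT (EFin \o X) -> measurable_fun setT X.
Proof. by move=> /measurable_int /measurable_EFinP. Qed.

Lemma integral_mean (X : T -> R) : P.-integrable setT (EFin \o X) ->
  (\int[P]_w (X w)%:E = (mean P X)%:E)%E.
Proof. by move=> iX; rewrite /mean unlock fineK // integrable_fin_num. Qed.

Lemma integrable_cst_fun (c : R) : P.-integrable setT (EFin \o (fun=> c)).
Proof. exact: finite_measure_integrable_cst. Qed.

Lemma integrable_affine (X : T -> R) (s c : R) :
  P.-integrable setT (EFin \o X) ->
  P.-integrable setT (EFin \o (fun w => s * X w + c)).
Proof.
move=> iX.
rewrite (_ : _ \o _ =
  (fun w => s%:E * (EFin \o X) w)%E \+ (EFin \o cst c)); last first.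
  by apply/funext => w /=; rewrite EFinD EFinM.
apply: integrableD => //; last exact: integrable_cst_fun.
exact: integrableZl.
Qed.

Lemma mean_affine (X : T -> R) (s c : R) : P.-integrable setT (EFin \o X) ->
  mean P (fun w => s * X w + c) = s * mean P X + c.
Proof.
move=> iX; apply: EFin_inj.
rewrite -integral_mean; last exact: integrable_affine.
under eq_integral => w _ do rewrite EFinD EFinM.
rewrite integralD //; last 2 first.
- exact: integrableZl.
- exact: integrable_cst_fun.
rewrite integralZl // integral_mean // -EFinM [RHS]EFinD; congr (_ + _)%E.
by have := expectation_cst P c; rewrite unlock.
Qed.

Lemma ge0_integral_comb (q r s : R) (f g h : T -> R) :
  0 <= q -> 0 <= r -> 0 <= s ->
  measurable_fun setT f -> measurable_fun setT g -> measurable_fun setT h ->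
  (forall w, 0 <= f w) -> (forall w, 0 <= g w) -> (forall w, 0 <= h w) ->
  (\int[P]_w (q * f w + r * g w + s * h w)%:E =
   q%:E * (\int[P]_w (f w)%:E) + r%:E * (\int[P]_w (g w)%:E)
   + s%:E * (\int[P]_w (h w)%:E))%E.
Proof.
move=> q0 r0 s0 mf mg mh f0 g0 h0.
have Z (t : R) (F : T -> R) :
    0 <= t -> measurable_fun setT F -> (forall w, 0 <= F w) ->
    (\int[P]_w (t * F w)%:E = t%:E * (\int[P]_w (F w)%:E))%E.
  move=> t0 mF F0; rewrite -ge0_integralZl //; last first.
    by move=> w _; rewrite lee_fin.
  exact/measurable_EFinP.
have M (t : R) (F : T -> R) : measurable_fun setT F ->
    measurable_fun setT (fun w => t * F w).
  by move=> mF; apply: measurable_funM.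
rewrite -!Z //.
under eq_integral => w _ do rewrite !EFinD.
rewrite ge0_integralD //.
- rewrite ge0_integralD //.
  + by move=> w _; rewrite lee_fin mulr_ge0.
  + by apply/measurable_EFinP; exact: M.
  + by move=> w _; rewrite lee_fin mulr_ge0.
  + by apply/measurable_EFinP; exact: M.
- by move=> w _; rewrite -EFinD lee_fin addr_ge0 // mulr_ge0.
- by apply: emeasurable_funD; apply/measurable_EFinP; exact: M.
- by move=> w _; rewrite lee_fin mulr_ge0.
- by apply/measurable_EFinP; exact: M.
Qed.

(** |X| <= 1 + |X|^m. *)
Lemma integrable_of_moment (m : nat) (X : T -> R) : (0 < m)%N ->
  measurable_fun setT X ->
  P.-integrable setT (EFin \o (fun w => X w ^+ m)) ->
  P.-integrable setT (EFin \o X).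
Proof.
move=> m0 mX iXm.
have i1 : P.-integrable setT ((EFin \o cst 1%R) \+
    (abse \o (EFin \o (fun w => (X w ^+ m)%R))))%E.
  apply: integrableD => //; first exact: integrable_cst_fun.
  exact: integrable_abse.
apply: le_integrable i1 => //; first exact/measurable_EFinP.
move=> w _ /=; rewrite lee_fin normrX.
rewrite [leRHS]ger0_norm ?addr_ge0 ?exprn_ge0 //.
have [X1|X1] := leP `|X w| 1.
  by rewrite (le_trans X1) // lerDl exprn_ge0.
by rewrite (@le_trans _ _ (`|X w| ^+ m)) ?lerDr // ler_eXnr // ltW.
Qed.

Section noise_step.
Variables (o : nat) (Y Z : T -> R).
Hypotheses (mY : measurable_fun setT Y) (mZ : measurable_fun setT Z).
Hypothesis YZ : independent_rv P Y Z.

Let mfunY : {mfun T >-> R} := HB.pack Y (isMeasurableFun.Build _ _ _ _ Y mY).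
Let mfunZ : {mfun T >-> R} := HB.pack Z (isMeasurableFun.Build _ _ _ _ Z mZ).

Lemma noise_step_moment (c : R) :
  mean P (fun w => c + Y w * Z w) = c ->
  P.-integrable setT (EFin \o (fun w => Z w ^+ (2 * o))) ->
  central_moment P (2 * o) (fun w => c + Y w * Z w) =
  ((fine 'E_P[fun w => Z w ^+ (2 * o)])%:E *
   'E_P[fun w => (Y w ^+ (2 * o))%R])%E.
Proof.
move=> mc iZ.
rewrite fineK; last by rewrite unlock integrable_fin_num.
rewrite /central_moment mc unlock muleC.
have X0 (t : R) : 0 <= t ^+ (2 * o) := exprn2_ge0 t o.
rewrite -(@ge0_independent_integralM _ _ _ P mfunY mfunZ YZ
  (fun t => t ^+ (2 * o)) (fun t => t ^+ (2 * o))) //.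
by apply: eq_integral => w _; rewrite addrC addKr exprMn.
Qed.

Hypotheses (iY : P.-integrable setT (EFin \o Y))
           (iZ : P.-integrable setT (EFin \o Z)) (Z0 : ('E_P[Z] = 0)%E).

Let iYZ : P.-integrable setT (EFin \o (fun w => Y w * Z w)).
Proof. exact: (@independent_integrableM _ _ _ P mfunY mfunZ). Qed.

Lemma noise_step_integrable (c : R) :
  P.-integrable setT (EFin \o (fun w => c + Y w * Z w)).
Proof.
rewrite (_ : (fun w => _) = (fun w => 1 * (Y w * Z w) + c)).
  exact: (@integrable_affine (fun w => Y w * Z w)).
by apply/funext => w; rewrite mul1r addrC.
Qed.

Lemma noise_step_mean (c : R) : mean P (fun w => c + Y w * Z w) = c.
Proof.
rewrite (_ : (fun w => _) = (fun w => 1 * (Y w * Z w) + c)); last first.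
  by apply/funext => w; rewrite mul1r addrC.
rewrite (@mean_affine (fun w => Y w * Z w)) // mul1r.
suff -> : mean P (fun w => Y w * Z w) = 0 by rewrite add0r.
apply: EFin_inj; rewrite -integral_mean //.
rewrite (@independent_integralM _ _ _ P mfunY mfunZ) //=.
by move: Z0; rewrite unlock => ->; rewrite mule0.
Qed.
End noise_step.
End affine.

(** * The closed loop *)

Section dynamics.
Context d (T : measurableType d) (R : realType) (P : probability T R).
Variables (n N o : nat) (eps : nat -> {RV P >-> R}) (x0 : {RV P >-> R}).
Variables (a abar : nat -> R) (b bbar : 'I_n -> nat -> R).
Hypotheses
  (heps_mean : forall k, (k <= N)%N -> ('E_P[eps k] = 0)%E)
  (heps_moment : forall k, (k <= N)%N ->
       P.-integrable setT (EFin \o (fun w => eps k w ^+ (2 * o))))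
  (heps_indep : mutually_independent N eps)
  (hx0_indep : independent_of_process N x0 eps) (ho : (1 <= o)%N).
Variable u : 'I_n -> strategy R.

Let x := state eps x0 a abar b bbar u.
Let c i k := control P (u i) k (x k).

Definition drift k : R :=
  abar k * mean P (x k) + \sum_(i < n) bbar i k * mean P (c i k).

Definition innovation k (w : T) : R :=
  a k * (x k w - mean P (x k))
  + \sum_(i < n) b i k * (c i k w - mean P (c i k)).

Let stateS k : x k.+1 = fun w => drift k + innovation k w * eps k.+1 w.
Proof. by []. Qed.

Section one_stage.
Variable k : nat.
Hypotheses (kN : (k < N)%N)
  (xk : past_measurable eps x0 k (x k))
  (ck : forall i, rv_sigma_algebra (c i k) `<=` rv_sigma_algebra (x k)).

Lemma innovation_past_measurable : past_measurable eps x0 k (innovation k).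
Proof.
have cP i : past_measurable eps x0 k (c i k) :=
  past_measurable_sub (ck (i := i)) xk.
rewrite /past_measurable /innovation; apply: measurable_funD.
  by apply: measurable_funM => //; apply: measurable_funB.
apply: measurable_sum => i.
by apply: measurable_funM => //; apply: measurable_funB => //; exact: cP.
Qed.

Lemma state_past_measurableS : past_measurable eps x0 k.+1 (x k.+1).
Proof.
rewrite /past_measurable stateS; apply: measurable_funD => //.
apply: measurable_funM; last exact: past_measurable_eps.
exact: (past_measurableS innovation_past_measurable).
Qed.

Let innovation_indep : independent_rv P (innovation k) (eps k.+1).
Proof. exact: (past_independent heps_indep _ _ innovation_past_measurable). Qed.

Hypotheses (ix : P.-integrable setT (EFin \o x k))
  (ic : forall i, P.-integrable setT (EFin \o c i k)).

Let innovation_integrable : P.-integrable setT (EFin \o innovation k).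
Proof.
pose F := fun w => a k * (x k w - mean P (x k)).
pose G i := fun w => b i k * (c i k w - mean P (c i k)).
have -> : EFin \o innovation k =
    (EFin \o F \+ (fun w => \sum_(i <- index_enum 'I_n) (EFin \o G i) w))%E.
  by apply/funext => w /=; rewrite sumEFin.
apply: integrableD => //.
  rewrite (_ : F = fun w => a k * x k w + - (a k * mean P (x k))).
    exact: (@integrable_affine _ _ _ P (x k)).
  by apply/funext => w; rewrite /F mulrBr.
apply: integrable_sum => // i _.
rewrite (_ : G i = fun w => b i k * c i k w + - (b i k * mean P (c i k))).
  exact: (@integrable_affine _ _ _ P (c i k)).
by apply/funext => w; rewrite /G mulrBr.
Qed.

Let eps_integrable : P.-integrable setT (EFin \o eps k.+1).
Proof.
apply: (@integrable_of_moment _ _ _ P (2 * o)) => //; last exact: heps_moment.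
by rewrite muln_gt0.
Qed.

Let mi := past_measurable_fun innovation_past_measurable.

Lemma state_integrableS : P.-integrable setT (EFin \o x k.+1).
Proof. exact: noise_step_integrable. Qed.

Lemma state_meanS : mean P (x k.+1) = drift k.
Proof. by apply: noise_step_mean => //; exact: heps_mean. Qed.

Lemma state_central_momentS : central_moment P (2 * o) (x k.+1) =
  ((noise_moment eps (2 * o) k.+1)%:E *
   'E_P[fun w => (innovation k w ^+ (2 * o))%R])%E.
Proof.
by apply: noise_step_moment => //; [exact: state_meanS|exact: heps_moment].
Qed.
End one_stage.
End dynamics.

Section feedback_well_posed.
Context d (T : measurableType d) (R : realType) (P : probability T R).
Variables (n N o : nat) (eps : nat -> {RV P >-> R}) (x0 : {RV P >-> R}).
Variables (a abar : nat -> R) (b bbar : 'I_n -> nat -> R).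
Hypotheses
  (ho : (1 <= o)%N)
  (heps_moment : forall k, (k <= N)%N ->
       P.-integrable setT (EFin \o (fun w => eps k w ^+ (2 * o))))
  (heps_indep : mutually_independent N eps)
  (hx0 : P.-integrable setT (EFin \o x0))
  (hx0_indep : independent_of_process N x0 eps).
Variables (u : 'I_n -> strategy R) (s t : 'I_n -> nat -> R).
Hypothesis uE : forall i k x y, u i k x y = s i k * x + t i k * y.

(** An affine feedback is a Borel function of the state, so integrability and
    measurability with respect to the past propagate from stage to stage. *)
Lemma affine_well_posed : well_posed N eps x0 a abar b bbar u.
Proof.
pose x := state eps x0 a abar b bbar u.
have controlE i k : control P (u i) k (x k) =
    (fun y => s i k * y + t i k * mean P (x k)) \o x k.
  by apply/funext => w; rewrite /control uE.
have ic i k : P.-integrable setT (EFin \o x k) ->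
    P.-integrable setT (EFin \o control P (u i) k (x k)).
  by move=> ix; rewrite controlE; exact: integrable_affine.
have cx i k :
    rv_sigma_algebra (control P (u i) k (x k)) `<=` rv_sigma_algebra (x k).
  rewrite controlE; apply: preimage_set_system_compS => //.
  by apply: measurable_funD => //; apply: measurable_funM.
have H k : (k <= N)%N -> past_measurable eps x0 k (x k) /\
    P.-integrable setT (EFin \o x k).
  elim: k => [|k IHk] kN; first by split=> //; exact: past_measurable_x0.
  have [mx ix] := IHk (ltnW kN); split.
    by apply: state_past_measurableS => // i; exact: cx.
  apply: (state_integrableS heps_moment heps_indep hx0_indep) => // i.
  by exact: ic.
split=> [k kN|i k kN]; first by have [] := H k kN.
by split; [apply: ic; have [] := H k (ltnW kN)|exact: cx].
Qed.
End feedback_well_posed.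

Lemma lebesgue_measurable_affine (R : realType) (N : nat) (v : strategy R)
    (s t : nat -> R) :
  (forall k x y, v k x y = s k * x + t k * y) ->
  lebesgue_measurable_strategy N v.
Proof.
move=> vE k _ B mB; exists ((fun y : R * R => v k y.1 y.2) @^-1` B).
  rewrite -[X in measurable X]setTI.
  have mv : measurable_fun setT (fun y : R * R => v k y.1 y.2).
    rewrite (_ : (fun _ => _) = fun y : R * R => s k * y.1 + t k * y.2).
      by apply: measurable_funD; apply: measurable_funM.
    by apply/funext => y; rewrite vE.
  exact: mv.
by exists set0; [exact: negligible_set0|rewrite setU0].
Qed.

(** * Dynamic programming *)

Lemma telescope_le (R : realType) (V c : nat -> \bar R) (N : nat) :
  (forall k, (k < N)%N -> V k <= c k + V k.+1)%E ->
  (V 0%N <= V N + \sum_(k < N) c k)%E.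
Proof.
elim: N => [|N IHN] step; first by rewrite big_ord0 adde0.
apply: (le_trans (IHN (fun k kN => step k (ltnW kN)))).
by rewrite big_ord_recr /= addeC [leRHS]addeC -addeA leeD2l // step.
Qed.

Lemma telescope_eq (R : realType) (V c : nat -> \bar R) (N : nat) :
  (forall k, (k < N)%N -> V k = c k + V k.+1)%E ->
  (V 0%N = V N + \sum_(k < N) c k)%E.
Proof.
elim: N => [|N IHN] step; first by rewrite big_ord0 adde0.
rewrite (IHN (fun k kN => step k (ltnW kN))) step //.
by rewrite big_ord_recr /= addeC [in RHS]addeC -addeA.
Qed.

Lemma noise_moment_ge0 d (T : measurableType d) (R : realType)
    (P : probability T R) (eps : nat -> {RV P >-> R}) m k :
  0 <= noise_moment eps (2 * m) k.
Proof. by rewrite fine_ge0 // expectation_ge0 // => w; exact: exprn2_ge0. Qed.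

Section value.
Context d (T : measurableType d) (R : realType) (P : probability T R).
Variables (n N o p : nat) (eps : nat -> {RV P >-> R}) (x0 : {RV P >-> R}).
Variables (a abar : nat -> R) (b bbar q qbar r rbar : 'I_n -> nat -> R).
Hypotheses
  (ho : (1 <= o)%N) (hp : (1 <= p)%N)
  (hq : forall i k, (k <= N)%N -> 0 < q i k /\ 0 < qbar i k)
  (hr : forall i k, (k < N)%N -> 0 < r i k /\ 0 < rbar i k)
  (heps_mean : forall k, (k <= N)%N -> ('E_P[eps k] = 0)%E)
  (heps_moment : forall k, (k <= N)%N ->
       P.-integrable setT (EFin \o (fun w => eps k w ^+ (2 * o))))
  (heps_indep : mutually_independent N eps)
  (hx0_indep : independent_of_process N x0 eps).
Variables (alpha alphabar : 'I_n -> nat -> R).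
Let mom := noise_moment eps (2 * o).
Hypotheses (halpha : solves_alpha N o mom a b q r alpha)
  (halphabar : solves_alpha_bar N p abar bbar qbar rbar alphabar).
Let g := gain_tilde o mom b r alpha.
Let h := gain_bar p bbar rbar alphabar.

Let feedback : 'I_n -> strategy R :=
  fun i k x xbar => - g k i * a k * (x - xbar) - h k i * abar k * xbar.

Let mom0 : forall k, 0 <= mom k := noise_moment_ge0 eps o.

Let qP i k (kN : (k <= N)%N) : 0 < q i k := (hq i kN).1.
Let rP i k (kN : (k < N)%N) : 0 < r i k := (hr i kN).1.
Let qbarP i k (kN : (k <= N)%N) : 0 < qbar i k := (hq i kN).2.
Let rbarP i k (kN : (k < N)%N) : 0 < rbar i k := (hr i kN).2.
Let halphabar1 := solves_alpha_bar_tilde halphabar.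
Let alpha0 i k (kN : (k <= N)%N) : 0 <= alpha i k :=
  alpha_ge0 mom0 qP rP halpha i kN.

Section profile.
Variables (u : 'I_n -> strategy R) (i : 'I_n).
Let x := state eps x0 a abar b bbar u.
Let c j k := control P (u j) k (x k).
Hypothesis wp : well_posed N eps x0 a abar b bbar u.

Let ix k : (k <= N)%N -> P.-integrable setT (EFin \o x k).
Proof. by case: wp => + _; exact. Qed.
Let ic j k : (k < N)%N -> P.-integrable setT (EFin \o c j k).
Proof. by case: wp => _ + kN => /(_ j k kN)[]. Qed.
Let cx j k : (k < N)%N -> rv_sigma_algebra (c j k) `<=` rv_sigma_algebra (x k).
Proof. by case: wp => _ + kN => /(_ j k kN)[]. Qed.

Lemma state_past_measurable k : (k <= N)%N -> past_measurable eps x0 k (x k).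
Proof.
elim: k => [|k IHk] kN; first exact: past_measurable_x0.
by apply: state_past_measurableS => [|j]; [exact: (IHk (ltnW kN))|exact: cx].
Qed.

Let xP := state_past_measurable.

Lemma control_feedback_mean j k : (k < N)%N -> u j k = feedback j k ->
  mean P (c j k) = - h k j * abar k * mean P (x k).
Proof.
move=> kN uE; rewrite /c /control uE /feedback.
rewrite (_ : (fun w => _) = (fun w => (- g k j * a k) * x k w +
  (g k j * a k * mean P (x k) - h k j * abar k * mean P (x k)))); last first.
  by apply/funext => w; ring.
by rewrite mean_affine; [ring|exact: (ix (ltnW kN))].
Qed.

Lemma control_feedback_center j k w : (k < N)%N -> u j k = feedback j k ->
  c j k w - mean P (c j k) = - g k j * a k * (x k w - mean P (x k)).
Proof.
move=> kN uE; rewrite control_feedback_mean // /c /control uE /feedback; ring.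
Qed.

(** The cost of agent i from stage k on if all agents use the feedback from the
    state x k onwards. *)
Definition value k : \bar R :=
  ((alpha i k)%:E * central_moment P (2 * o) (x k)
   + ((alphabar i k * mean P (x k) ^+ (2 * p))%R)%:E)%E.

Definition stage_cost k : \bar R :=
  ((q i k)%:E * central_moment P (2 * o) (x k)
        + ((qbar i k * mean P (x k) ^+ (2 * p))%R)%:E
        + (r i k)%:E * central_moment P (2 * o) (c i k)
        + ((rbar i k * mean P (c i k) ^+ (2 * p))%R)%:E)%E.

Section stage.
Variables (k : nat) (kN : (k < N)%N).

Let mx := past_measurable_fun (xP (ltnW kN)).
Let mc j := integrable_measurable_fun (ic j kN).
Let innov := innovation eps x0 a abar b bbar u k.
Let minnov : measurable_fun setT innov.
Proof.
apply: (@past_measurable_fun _ _ _ _ eps x0 k).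
apply: innovation_past_measurable; first exact: (xP (ltnW kN)).
by move=> j; exact: cx.
Qed.

Let mpow (F : T -> R) (t : R) m : measurable_fun setT F ->
  measurable_fun setT (fun w => (F w - t) ^+ m).
Proof. by move=> mF; apply/measurable_funX/measurable_funB. Qed.

Let next_centralE : ((q i k)%:E * central_moment P (2 * o) (x k)
     + (r i k)%:E * central_moment P (2 * o) (c i k)
     + (alpha i k.+1)%:E * central_moment P (2 * o) (x k.+1) =
   \int[P]_w (q i k * (x k w - mean P (x k)) ^+ (2 * o)
     + r i k * (c i k w - mean P (c i k)) ^+ (2 * o)
     + alpha i k.+1 * mom k.+1 * innov w ^+ (2 * o))%R%:E)%E.
Proof.
rewrite (state_central_momentS heps_mean heps_moment heps_indep hx0_indep) //;
  [|exact: (xP (ltnW kN))|by move=> j; exact: cx|exact: (ix (ltnW kN))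
   |by move=> j; exact: ic].
rewrite /central_moment muleA -EFinM unlock ge0_integral_comb //.
- by rewrite ltW // (hq i (ltnW kN)).1.
- by rewrite ltW // (hr i kN).1.
- by rewrite mulr_ge0 ?alpha0.
- exact: mpow.
- exact: mpow.
- exact: measurable_funX.
- by move=> w; exact: exprn2_ge0.
- by move=> w; exact: exprn2_ge0.
- by move=> w; exact: exprn2_ge0.
Qed.

Let alpha_centralE : ((alpha i k)%:E * central_moment P (2 * o) (x k) =
   \int[P]_w (alpha i k * (x k w - mean P (x k)) ^+ (2 * o))%R%:E)%E.
Proof.
rewrite /central_moment unlock -ge0_integralZl //.
- by apply/measurable_EFinP; exact: mpow.
- by move=> w _; rewrite lee_fin exprn2_ge0.
- by rewrite lee_fin alpha0 // ltnW.
Qed.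

Let stage_splitE : (stage_cost k + value k.+1 =
  ((q i k)%:E * central_moment P (2 * o) (x k)
     + (r i k)%:E * central_moment P (2 * o) (c i k)
     + (alpha i k.+1)%:E * central_moment P (2 * o) (x k.+1))
  + (qbar i k * mean P (x k) ^+ (2 * p) + rbar i k * mean P (c i k) ^+ (2 * p)
     + alphabar i k.+1 * mean P (x k.+1) ^+ (2 * p))%R%:E)%E.
Proof.
rewrite /stage_cost /value !EFinD.
rewrite -[X in (X + _)%E]addeA [X in (X + _)%E]addeACA; exact: addeACA.
Qed.

Let next_meanE : mean P (x k.+1) =
  abar k * mean P (x k) + \sum_j bbar j k * mean P (c j k).
Proof.
apply: (state_meanS heps_mean heps_moment heps_indep hx0_indep) => //;
  [exact: (xP (ltnW kN))|by move=> j; exact: cx|exact: (ix (ltnW kN))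
  |by move=> j; exact: ic].
Qed.

(** The centered terms and the means decouple: the former are compared pointwise
    under the integral, the latter as real numbers. *)
Lemma value_le : (forall j, j != i -> u j k = feedback j k) ->
  (value k <= stage_cost k + value k.+1)%E.
Proof.
move=> uE; rewrite stage_splitE next_centralE {1}/value alpha_centralE.
apply: leeD.
  apply: ge0_le_integral => //.
  - by move=> w _; rewrite lee_fin mulr_ge0 ?exprn2_ge0 // alpha0 // ltnW.
  - by apply/measurable_EFinP/measurable_funM => //; exact: mpow.
  - apply/measurable_EFinP/measurable_funD; last first.
      by apply: measurable_funM => //; exact: measurable_funX.
    by apply: measurable_funD; apply: measurable_funM => //; exact: mpow.
  move=> w _; rewrite lee_fin.
  apply: (alpha_cost_le ho mom0 qP rP halpha kN
    (v := fun j => c j k w - mean P (c j k))) => j ji.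
  by rewrite control_feedback_center // uE.
rewrite lee_fin next_meanE -[alphabar i k.+1]mulr1.
apply: (alpha_cost_le hp (fun=> ler01) qbarP rbarP halphabar1 kN
  (v := fun j => mean P (c j k))) => j ji.
by rewrite -gain_bar_tilde control_feedback_mean ?uE.
Qed.

Lemma value_eq : (forall j, u j k = feedback j k) ->
  (value k = stage_cost k + value k.+1)%E.
Proof.
move=> uE; rewrite stage_splitE next_centralE {1}/value alpha_centralE.
congr (_ + _)%E.
  apply: eq_integral => w _; congr EFin.
  apply: (alpha_cost_eq halpha kN i
    (v := fun j => c j k w - mean P (c j k))) => j.
  by rewrite control_feedback_center.
congr EFin; rewrite next_meanE -[alphabar i k.+1]mulr1.
apply: (alpha_cost_eq halphabar1 kN i (v := fun j => mean P (c j k))) => j.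
by rewrite -gain_bar_tilde control_feedback_mean.
Qed.
End stage.

Let costE : cost N o p eps x0 a abar b bbar q qbar r rbar u i =
  (value N + \sum_(k < N) stage_cost k)%E.
Proof.
by rewrite /value halpha.1 halphabar.1.
Qed.

Lemma value_le_cost : (forall j k, j != i -> u j k = feedback j k) ->
  (value 0 <= cost N o p eps x0 a abar b bbar q qbar r rbar u i)%E.
Proof.
move=> uE; rewrite costE; apply: telescope_le => k kN.
by apply: value_le => // j ji; exact: uE.
Qed.

Lemma value_eq_cost : u = feedback ->
  value 0 = cost N o p eps x0 a abar b bbar q qbar r rbar u i.
Proof.
move=> uE; rewrite costE; apply: telescope_eq => k kN.
by apply: value_eq => // j; rewrite uE.
Qed.
End profile.
End value.

Theorem proposition7 (R : realType) (d : measure_display)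
    (T : measurableType d) (P : probability T R)
    (o p n N : nat) (ho : (1 <= o)%N) (hp : (1 <= p)%N)
    (hn : (2 <= n)%N) (hN : (1 <= N)%N)
    (a abar : nat -> R) (b bbar q qbar r rbar : 'I_n -> nat -> R)
    (hq : forall i k, (k <= N)%N -> 0 < q i k /\ 0 < qbar i k)
    (hr : forall i k, (k < N)%N -> 0 < r i k /\ 0 < rbar i k)
    (eps : nat -> {RV P >-> R}) (x0 : {RV P >-> R})
    (heps0 : forall w, eps 0%N w = 0)
    (heps_mean : forall k, (k <= N)%N -> ('E_P[eps k] = 0)%E)
    (heps_moment : forall k, (k <= N)%N ->
       P.-integrable setT (EFin \o (fun w => eps k w ^+ (2 * o))))
    (heps_indep : mutually_independent N eps)
    (hx0 : P.-integrable setT (EFin \o x0))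
    (hx0_indep : independent_of_process N x0 eps)
    (alpha alphabar : 'I_n -> nat -> R)
    (halpha : solves_alpha N o (noise_moment eps (2 * o)) a b q r alpha)
    (halphabar : solves_alpha_bar N p abar bbar qbar rbar alphabar) :
  (forall k, (k < N)%N ->
     E_tilde o (noise_moment eps (2 * o)) b r alpha k \in unitmx /\
     E_bar p bbar rbar alphabar k \in unitmx) /\
  feedback_nash_equilibrium N o p eps x0 a abar b bbar q qbar r rbar
    (fun i k x xbar =>
       - gain_tilde o (noise_moment eps (2 * o)) b r alpha k i
           * a k * (x - xbar)
       - gain_bar p bbar rbar alphabar k i * abar k * xbar).
Proof.
split=> [k kN|].
  split.
    exact: (E_tilde_unit (noise_moment_ge0 eps o)
      (fun j l lN => (hq j l lN).1) (fun j l lN => (hr j l lN).1) halpha kN).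
  rewrite /E_bar c_bar_tilde.
  exact: (E_tilde_unit (fun=> ler01) (fun j l lN => (hq j l lN).2)
    (fun j l lN => (hr j l lN).2) (solves_alpha_bar_tilde halphabar) kN).
set u := fun (i : 'I_n) k x xbar => _.
pose g := gain_tilde o (noise_moment eps (2 * o)) b r alpha.
pose h := gain_bar p bbar rbar alphabar.
have uE i k x y : u i k x y =
    (- (g k i * a k)) * x + (g k i * a k - h k i * abar k) * y.
  by rewrite /u -/g -/h; ring.
have wp : well_posed N eps x0 a abar b bbar u.
  exact: (affine_well_posed a abar b bbar ho heps_moment heps_indep
    hx0 hx0_indep uE).
split=> // [i|i v mv wpv]; first exact: (lebesgue_measurable_affine (uE i)).
rewrite -(value_eq_cost ho hq hr heps_mean heps_moment heps_indep
  hx0_indep halpha halphabar i wp) //.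
(* The value at stage 0 is a function of x0, the same for both profiles. *)
apply: (value_le_cost ho hp hq hr heps_mean heps_moment heps_indep
  hx0_indep halpha halphabar wpv) => j k ji.
by rewrite /deviate (negbTE ji).
Qed.
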